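(* Suppose that $f$ has the MLR property, i.e. $f(x_1-\eta_1)f(x_2-\eta_2)\ge f(x_1-\eta_2)f(x_2-\eta_1)$ whenever $x_1<x_2$ and $\eta_1<\eta_2$, and that $W$ satisfies (C1)--(C3) (listed in the context). Let $m_0$ be such that $\int_{-\infty}^{m_0}f(x)\,dx=\frac12$, and for $u>0$ let $m(\boldsymbol0,u)$ be the median of the conditional distribution of $X_{(2)}-\theta_{(2)}$ given $U=u$ when $\boldsymbol\theta=\boldsymbol0=(0,0)$. If $P_{\boldsymbol\theta}(m(\boldsymbol0,U)<m_0)\ne0$ for some $\boldsymbol\theta\in\mathbb{R}^2$, then, under the generalized Pitman nearness criterion with loss $W(a-\theta_{(2)})$, the estimator $$\delta^*_{PN}(\mathbf X)=X_{(2)}-\min\{m_0,m(\boldsymbol0,U)\}$$ is Pitman nearer to $\theta_{(2)}$ than $\delta_{PN}(\mathbf X)=X_{(2)}-m_0$; that is, $GPN(\delta^*_{PN},\delta_{PN};\boldsymbol\theta)\ge\frac12$ for all $\boldsymbol\theta\in\mathbb{R}^2$, with strict inequality for some $\boldsymbol\theta$.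
   Context: Setting: $f$ is a Lebesgue probability density on $\mathbb{R}$; $X_1,X_2$ are independent and $X_i$ has density $x\mapsto f(x-\theta_i)$, where $\boldsymbol\theta=(\theta_1,\theta_2)\in\mathbb{R}^2$ is unknown. Write $\theta_{(1)}=\min\{\theta_1,\theta_2\}$, $\theta_{(2)}=\max\{\theta_1,\theta_2\}$, $X_{(1)}=\min\{X_1,X_2\}$, $X_{(2)}=\max\{X_1,X_2\}$, $U=X_{(2)}-X_{(1)}$, $\mathbf X=(X_1,X_2)$. With $\theta=\theta_{(2)}-\theta_{(1)}\ge0$, the conditional distribution of $X_{(2)}-\theta_{(2)}$ given $U=u>0$ has density proportional to $z\mapsto f(z-u+\theta)f(z)+f(z-u)f(z+\theta)$; implicitly it is well defined and has a unique median. For $\boldsymbol\theta=\boldsymbol0$ the density is proportional to $f(z-u)f(z)$. Generalized Pitman nearness: for estimators $\delta_1,\delta_2$ of $\theta_{(2)}$ and loss $L(\boldsymbol\theta,a)=W(a-\theta_{(2)})$, $GPN(\delta_1,\delta_2;\boldsymbol\theta)=P_{\boldsymbol\theta}[L(\boldsymbol\theta,\delta_1)<L(\boldsymbol\theta,\delta_2)]+\frac12P_{\boldsymbol\theta}[L(\boldsymbol\theta,\delta_1)=L(\boldsymbol\theta,\delta_2)]$. Conditions on $W:\mathbb{R}\to[0,\infty)$: (C1) $W(0)=0$, $W$ is strictly decreasing on $(-\infty,0)$ and strictly increasing on $(0,\infty)$; (C2) $W'$ is increasing almost everywhere; (C3) the integrals involving $W$ are finite and differentiation under the integral sign is permissible.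 *)

(* Defs.v *)
From HB Require Import structures.
From mathcomp Require Import all_boot all_order all_algebra.
From mathcomp Require Import all_classical all_reals all_analysis.

Set Implicit Arguments.
Unset Strict Implicit.
Unset Printing Implicit Defensive.

Import Order.TTheory GRing.Theory Num.Theory.
Import numFieldNormedType.Exports.

Local Open Scope classical_set_scope.
Local Open Scope ring_scope.

Section Defs.
Variable R : realType.
Implicit Types (f g W : R -> R) (th p : R * R) (u m x y : R).

Local Notation leb := (@lebesgue_measure R).

Definition is_density f : Prop :=
  [/\ measurable_fun setT f, forall x, 0 <= f x
    & (\int[leb]_x (f x)%:E = 1)%E].

Definition MLR f : Prop :=
  forall x1 x2 eta1 eta2 : R, x1 < x2 -> eta1 < eta2 ->
    f (x1 - eta2) * f (x2 - eta1) <= f (x1 - eta1) * f (x2 - eta2).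

(* Order statistics of a pair, used both for the parameter and the sample. *)
Definition ord1 p : R := Num.min p.1 p.2.
Definition ord2 p : R := Num.max p.1 p.2.
Definition spread p : R := ord2 p - ord1 p.

Definition has_density d (T : measurableType d) (P : probability T R)
    (X : T -> R) g : Prop :=
  forall A : set R, measurable A ->
    (P (X @^-1` A) = \int[leb]_(x in A) (g x)%:E)%E.

Definition indep2 d (T : measurableType d) (P : probability T R)
    (X Y : T -> R) : Prop :=
  forall A B : set R, measurable A -> measurable B ->
    (P ((X @^-1` A) `&` (Y @^-1` B)) = P (X @^-1` A) * P (Y @^-1` B))%E.

Definition location_model d (T : measurableType d) f
    (P : R * R -> probability T R) (X1 X2 : T -> R) : Prop :=
  forall th, [/\ indep2 (P th) X1 X2,
    has_density (P th) X1 (fun x => f (x - th.1))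
    & has_density (P th) X2 (fun x => f (x - th.2))].

(* Unnormalised density of X_(2) - theta_(2) given U = u, where U is the
   spread of the sample. *)
Definition cond_weight f th u (z : R) : R :=
  f (z - u + spread th) * f z + f (z - u) * f (z + spread th).

(* If the normalising constant is 0 or infinite, [Rintegral] is 0, hence so are
   this quotient and [cond_law], which then has no median. *)
Definition cond_density f th u (z : R) : R :=
  cond_weight f th u z / Rintegral leb setT (cond_weight f th u).

Definition cond_law f th u (A : set R) : \bar R :=
  (\int[leb]_(z in A) (cond_density f th u z)%:E)%E.

Definition is_median (mu : set R -> \bar R) m : Prop :=
  ((2^-1)%:E <= mu [set` `]-oo, m]])%E /\ ((2^-1)%:E <= mu [set` `[m, +oo[])%E.

(* Only meaningful when the median exists and is unique; it is 0 when there is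
   no median. *)
Definition cond_median f th u : R := xget 0 (is_median (cond_law f th u)).

Definition C1 W : Prop :=
  [/\ W 0 = 0,
      forall x y, x < y -> y < 0 -> W y < W x
    & forall x y, 0 < x -> x < y -> W x < W y].

Definition C2 W : Prop :=
  exists2 N : set R, leb.-negligible N &
    (forall x, ~ N x -> derivable W x 1) /\
    (forall x y, ~ N x -> ~ N y -> x < y -> derive1 W x <= derive1 W y).

(* Regularity of c |-> E[W(Z - c)] for Z with (unnormalised) density g. *)
Definition smooth_risk W g : Prop :=
  forall c : R,
  [/\ leb.-integrable setT (fun z => (W (z - c) * g z)%:E),
      leb.-integrable setT (fun z => (derive1 W (z - c) * g z)%:E)
    & is_derive c 1
        (fun c' => Rintegral leb setT (fun z => W (z - c') * g z))
        (- Rintegral leb setT (fun z => derive1 W (z - c) * g z))].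

(* The integrals involving W are its expectations under f (the law of
   X_i - theta_i) and under the conditional laws of X_(2) - theta_(2). *)
Definition C3 f W : Prop :=
  smooth_risk W f /\
  forall th u, 0 < u -> smooth_risk W (cond_weight f th u).

(* Generalized Pitman nearness of delta1 relative to delta2 for theta_(2). *)
Definition GPN d (T : measurableType d) (P : R * R -> probability T R)
    (X1 X2 : T -> R) W (delta1 delta2 : R * R -> R) th : \bar R :=
  let L delta w := W (delta (X1 w, X2 w) - ord2 th) in
  (P th [set w | (L delta1 w < L delta2 w)%R]
   + (2^-1)%:E * P th [set w | L delta1 w = L delta2 w])%E.

Definition pitman_nearer d (T : measurableType d) (P : R * R -> probability T R)
    (X1 X2 : T -> R) W (delta1 delta2 : R * R -> R) : Prop :=
  (forall th, ((2^-1)%:E <= GPN P X1 X2 W delta1 delta2 th)%E) /\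
  (exists th, ((2^-1)%:E < GPN P X1 X2 W delta1 delta2 th)%E).

Definition delta_PN (m0 : R) p : R := ord2 p - m0.

Definition delta_PN_star f (m0 : R) p : R :=
  ord2 p - Num.min m0 (cond_median f (0, 0) (spread p)).

End Defs.

(* Main.v *)
Require Import Defs.
From HB Require Import structures.
From mathcomp Require Import all_boot all_order all_algebra.
From mathcomp Require Import all_classical all_reals all_analysis.
From mathcomp Require Import measurable_realfun ring lra.
Import Order.TTheory GRing.Theory Num.Theory.
Import numFieldNormedType.Exports.
Local Open Scope classical_set_scope.
Local Open Scope ring_scope.

(* Let m(u) be the median of the null conditional law given U = u, and let
   Z = X_(2) - theta_(2). The two estimators differ only on the event
   A = {m(U) < m0}. There, if Z <= m(U), the errors satisfy
   Z - m0 < Z - m(U) <= 0, so (C1) alone makes the starred loss strictly smaller.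
   Hence GPN >= P(A, Z <= m(U)) + P(not A) / 2, and it suffices to compare
   P(A, Z <= m(U)) with P(A, Z > m(U)).
   Conditionally on U = u, the law of Z is a mixture of densities of the form
   w(z) phi(z + t), with t = theta_(2) - theta_(1), where the null density is
   w(z) phi(z) and phi has monotone likelihood ratio; the ratio
   phi(z + t) / phi(z) decreases, so the mass moves below m(u).
   Strictness: since the null law has a median for every u > 0, its mass is
   positive, so the support of f, an interval by MLR, is unbounded on one side.
   If no mass moved, the ratio phi(z + t) / phi(z) would be almost everywhere a
   constant, necessarily 1, and phi would vanish just above m(u), which a
   suitable choice of the mixture component excludes for 0 < t < u. Taking
   t = 1/n with n large enough keeps a non-null part of A in {u > t}. *)

Set Implicit Arguments.
Unset Strict Implicit.
Unset Printing Implicit Defensive.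

(** * Lebesgue integrals on the line *)

Section lebesgue_shift.
Context {R : realType}.
Local Notation leb := (@lebesgue_measure R).

(** Lebesgue measure is the only measure giving each bounded half-open interval its length, and a
    translation preserves these lengths. *)
Lemma pushforward_lebesgue_shift (c : R) (A : set R) : measurable A ->
  pushforward leb (fun x : measurableTypeR R => x + c : measurableTypeR R) A =
  leb A.
Proof.
move=> mA; pose h (x : measurableTypeR R) : measurableTypeR R := x + c.
have mc : measurable_fun setT h by exact: measurable_funD.
pose mf := isMeasurableFun.Build _ _ _ _ _ mc.
pose sf : {mfun measurableTypeR R >-> measurableTypeR R} := HB.pack h mf.
apply/esym; apply: (@lebesgue_measure_unique _ (pushforward leb sf)) => //=.
move=> _ [[a b]] _ <-; rewrite /pushforward/=.
rewrite (_ : _ @^-1` _ = `]a - c, b - c]%classic).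
  rewrite !lebesgue_measure_itv/= !lte_fin ltrD2r; case: ifPn => // _.
  by rewrite -EFinB; congr EFin; lra.
by apply/seteqP; split => x/=; rewrite !in_itv/= ltrBlDr lerBrDr.
Qed.

Lemma ge0_integral_shift_preimage (c : R) (D : set R) (h : R -> \bar R) :
  measurable D -> measurable_fun D h -> (forall x, D x -> 0 <= h x)%E ->
  (\int[leb]_(x in [set x | D (x + c)%R]) h (x + c)%R =
   \int[leb]_(x in D) h x)%E.
Proof.
move=> mD mh h0.
have mc : measurable_fun setT
    (fun x : measurableTypeR R => x + c : measurableTypeR R).
  exact: measurable_funD.
transitivity (\int[pushforward leb
    (fun x : measurableTypeR R => (x + c)%R : measurableTypeR R)]_(x in D) h x)%E.
  by rewrite ge0_integral_pushforward// => x /set_mem; exact: h0.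
by apply: eq_measure_integral => A mA _; exact: pushforward_lebesgue_shift.
Qed.

Lemma ge0_integral_shift (c : R) (h : R -> \bar R) : measurable_fun setT h ->
  (forall x, 0 <= h x)%E -> (\int[leb]_x h (x + c)%R = \int[leb]_x h x)%E.
Proof.
move=> mh h0.
by rewrite -(ge0_integral_shift_preimage c measurableT mh (fun x _ => h0 x)).
Qed.

Lemma ge0_integral_oppr (h : R -> \bar R) : measurable_fun setT h ->
  (forall x, 0 <= h x)%E -> (\int[leb]_x h (- x)%R = \int[leb]_x h x)%E.
Proof.
move=> mh h0.
have mN : measurable_fun setT (-%R : measurableTypeR R -> measurableTypeR R).
  exact: oppr_measurable.
rewrite -(@ge0_integral_pushforward _ _ _ _ R _ mN leb setT)//.
by apply: eq_measure_integral => A mA _; exact: lebesgue_measureN.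
Qed.

Lemma ge0_integral_reflect (c : R) (h : R -> \bar R) : measurable_fun setT h ->
  (forall x, 0 <= h x)%E -> (\int[leb]_x h (c - x)%R = \int[leb]_x h x)%E.
Proof.
move=> mh h0.
rewrite -(@ge0_integral_shift c h)// -(@ge0_integral_oppr (fun x => h (x + c)%R))//.
  by apply: eq_integral => x _; rewrite addrC.
apply: (@measurableT_comp _ _ _ _ _ _ h) => //; exact: measurable_funD.
Qed.

End lebesgue_shift.

Section le_integral_eq.
Context d (T : measurableType d) (R : realType) (mu : {measure set T -> \bar R}).
Local Open Scope ereal_scope.

(** A strict deficit of [a] on some measurable [E] could not be made up on the rest of [D], where
    still [a <= b]. So the integrals agree on every measurable subset, which forces equality almost
    everywhere. *)
Lemma ge0_le_integral_ae_eq (D : set T) (a b : T -> \bar R) : measurable D ->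
  measurable_fun D a -> measurable_fun D b ->
  (forall x, D x -> 0 <= a x) -> (forall x, D x -> a x <= b x) ->
  \int[mu]_(x in D) b x < +oo ->
  \int[mu]_(x in D) a x = \int[mu]_(x in D) b x -> ae_eq mu D b a.
Proof.
move=> mD ma mb a0 ab boo eqab.
have b0 x : D x -> 0 <= b x by move=> Dx; exact: le_trans (a0 x Dx) (ab x Dx).
have bi : mu.-integrable D b.
  apply/integrableP; split => //; rewrite (eq_integral b)// => x.
  by rewrite inE => /b0; exact: gee0_abs.
apply: integral_ae_eq => // E ED mE.
have DE : D = E `|` D `\` E by rewrite setDUK.
have mDE : measurable (D `\` E) by exact: measurableD.
have split h : measurable_fun D h -> (forall x, D x -> 0 <= h x) ->
    \int[mu]_(x in D) h x = \int[mu]_(x in E) h x + \int[mu]_(x in D `\` E) h x.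
  move=> mh h0; rewrite {1}DE ge0_integral_setU// -?DE//.
  by apply/disj_set2P; rewrite setDE setICA setICr setI0.
have leE F : F `<=` D -> measurable F ->
    \int[mu]_(x in F) a x <= \int[mu]_(x in F) b x.
  move=> FD mF; apply: ge0_le_integral => //.
  - by move=> x /FD; exact: a0.
  - exact: measurable_funS ma.
  - exact: measurable_funS mb.
  - by move=> x /FD; exact: ab.
apply/eqP; rewrite eq_le leE// andbT leNgt; apply/negP => lt_ab.
have : \int[mu]_(x in D) a x < \int[mu]_(x in D) b x.
  rewrite !split//; apply: lte_leD => //; last exact: leE.
  have DED : D `\` E `<=` D by move=> x [].
  rewrite ge0_fin_numE; last by apply: integral_ge0 => x /DED; exact: a0.
  apply: le_lt_trans boo; apply: le_trans (leE _ DED mDE) _.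
  exact: ge0_subset_integral.
by rewrite eqab ltxx.
Qed.
End le_integral_eq.

(** A zero integral would make [phi] vanish almost everywhere on the interval; as it vanishes
    nowhere there, the interval would be negligible. *)
Lemma integral_itvoo_gt0 {R : realType} (phi : R -> R) (a b : R) : a < b ->
  measurable_fun setT phi -> (forall x, a < x -> x < b -> 0 < phi x) ->
  (0 < \int[@lebesgue_measure R]_(x in `]a, b[) (phi x)%:E)%E.
Proof.
move=> ab mphi phi_gt0.
have mE : measurable_fun `]a, b[ (EFin \o phi).
  by apply: measurable_funTS; exact/measurable_EFinP.
rewrite lt0e; apply/andP; split; last first.
  apply: integral_ge0 => x /=; rewrite in_itv/= => /andP[ax xb].
  by rewrite lee_fin ltW// phi_gt0.
apply/negP => /eqP int0.
have : ae_eq (@lebesgue_measure R) [set` `]a, b[] (EFin \o phi) (cst 0%E).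
  apply/ae_eq_integral_abs => //; rewrite -[RHS]int0.
  apply: eq_integral => x; rewrite inE/= in_itv/= => /andP[ax xb].
  by rewrite gtr0_norm// phi_gt0.
case=> N [mN N0] subN.
have abN : `]a, b[%classic `<=` N.
  move=> x xab; apply: subN => /= /(_ xab)[] phix0.
  move: xab; rewrite /= in_itv/= => /andP[ax xb].
  by have := phi_gt0 _ ax xb; rewrite phix0 ltxx.
have : (@lebesgue_measure R [set` `]a, b[] = 0)%E.
  exact: subset_measure0 N0.
rewrite lebesgue_measure_itv/= lte_fin ab -EFinB => -[] /eqP.
by rewrite subr_eq0 gt_eqF.
Qed.

(** * Shifting one factor of a density moves mass below its median *)

Section ratio.
Context {R : realType}.
Local Notation leb := (@lebesgue_measure R).
Variables (w phi : R -> R) (m t K : R).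
Hypotheses (mw : measurable_fun setT w) (w0 : forall x, 0 <= w x).
Hypotheses (mphi : measurable_fun setT phi) (phi0 : forall x, 0 <= phi x).
Hypothesis phi_lr : forall x y, x < y -> phi x * phi (y + t) <= phi (x + t) * phi y.
(** [k] stands for the null density, cut by [m] into two halves of mass [K]; [g] is the same product
    with one factor shifted by [t]. *)
Let k x := w x * phi x.
Let g x := w x * phi (x + t).
Let lo : set R := [set` `]-oo, m]].
Let hi : set R := [set` `]m, +oo[].
Hypotheses (K0 : 0 < K) (klo : (\int[leb]_(x in lo) (k x)%:E = K%:E)%E).
Hypothesis khi : (\int[leb]_(x in hi) (k x)%:E = K%:E)%E.

Let mphit : measurable_fun setT (fun x : R => phi (x + t)).
Proof.
by apply: (@measurableT_comp _ _ _ _ _ _ phi) => //; exact: measurable_funD.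
Qed.
Let mg : measurable_fun setT g. Proof. exact: measurable_funM. Qed.
Let mk : measurable_fun setT k. Proof. exact: measurable_funM. Qed.
Let mE D h : measurable_fun setT h -> measurable_fun D (fun x : R => (h x : R)%:E).
Proof. by move=> mh; apply: measurable_funTS; exact/measurable_EFinP. Qed.
Let k0 x : 0 <= k x. Proof. exact: mulr_ge0. Qed.
Let g0 x : 0 <= g x. Proof. exact: mulr_ge0. Qed.
Let mlo : measurable lo. Proof. exact: measurable_itv. Qed.
Let mhi : measurable hi. Proof. exact: measurable_itv. Qed.

(** This says that [g / k] is nonincreasing, cross-multiplied because [k] may vanish. *)
Let gk x y : x < y -> k x * g y <= g x * k y.
Proof.
move=> /phi_lr h; rewrite /k /g.
rewrite [leLHS]mulrACA [leRHS]mulrACA.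
by rewrite ler_wpM2l// mulr_ge0.
Qed.

Let integral_scale (c : R) (D : set R) (h : R -> R) : 0 <= c -> measurable D ->
  measurable_fun setT h -> (forall x, 0 <= h x) ->
  (c%:E * \int[leb]_(x in D) (h x)%:E = \int[leb]_(x in D) (c * h x)%:E)%E.
Proof.
move=> c0 mD mh h0; rewrite -ge0_integralZl//; first exact: mE.
by move=> z _; rewrite lee_fin.
Qed.

Let integral_scaler (c : \bar R) (D : set R) (h : R -> R) : (0 <= c)%E -> measurable D ->
  measurable_fun setT h -> (forall x, 0 <= h x) ->
  (\int[leb]_(x in D) (h x)%:E * c = \int[leb]_(x in D) ((h x)%:E * c))%E.
Proof.
move=> c0 mD mh h0; rewrite -ge0_integralZr//; first exact: mE.
by move=> z _; rewrite lee_fin.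
Qed.

(** Obtained by integrating [gk] in its second argument over [hi], where [k] has mass [K]; [hi_le]
    integrates in the first argument over [lo]. *)
Let lo_le x : x \in lo ->
  ((k x)%:E * \int[leb]_(y in hi) (g y)%:E <= (g x)%:E * K%:E)%E.
Proof.
rewrite inE /lo/= in_itv/= => xm.
rewrite -khi !integral_scale//.
apply: ge0_le_integral => //.
- by move=> y _; rewrite lee_fin mulr_ge0.
- by apply: mE; exact: measurable_funM.
- by apply: mE; exact: measurable_funM.
- move=> y; rewrite /hi/= in_itv/= andbT => my; rewrite lee_fin.
  exact: gk (le_lt_trans xm my).
Qed.

Let hi_le y : y \in hi ->
  ((g y)%:E * K%:E <= (k y)%:E * \int[leb]_(x in lo) (g x)%:E)%E.
Proof.
rewrite inE /hi/= in_itv/= andbT => my.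
rewrite -klo !integral_scale//.
apply: ge0_le_integral => //.
- by move=> x _; rewrite lee_fin mulr_ge0.
- by apply: mE; exact: measurable_funM.
- by apply: mE; exact: measurable_funM.
- move=> x; rewrite /lo/= in_itv/= => xm; rewrite lee_fin.
  by rewrite mulrC (mulrC (k y)); exact: gk (le_lt_trans xm my).
Qed.

(** Integrating [lo_le] over [lo] gives the inequality multiplied by [K]. The integrals of [g] may
    be infinite here. *)
Lemma shifted_mass_le :
  (\int[leb]_(y in hi) (g y)%:E <= \int[leb]_(x in lo) (g x)%:E)%E.
Proof.
rewrite -(@lee_pmul2r _ K%:E) ?lte_fin// muleC -{1}klo.
have G0 : (0 <= \int[leb]_(y in hi) (g y)%:E)%E.
  by apply: integral_ge0 => x _; rewrite lee_fin.
have K0' := ltW K0; rewrite !integral_scaler//.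
apply: ge0_le_integral => //.
- by move=> x _; rewrite mule_ge0 ?lee_fin.
- by apply: emeasurable_funM => //; exact: mE.
- by apply: emeasurable_funM => //; exact: mE.
- by move=> x xlo; apply: lo_le; rewrite inE.
Qed.

Hypothesis t0 : 0 < t.
Hypothesis phi1 : (\int[leb]_x (phi x)%:E = 1)%E.
Hypothesis w_supp : forall x, w x = 0 -> phi x = 0 /\ phi (x + t) = 0.
Hypothesis glo : (\int[leb]_(x in lo) (g x)%:E < +oo)%E.
Variable e : R.
Hypotheses (e0 : 0 < e) (phi_pos : forall x, m < x -> x < m + e -> 0 < phi x).

(** In case of equality, [lo_le] and [hi_le] compare functions with equal finite integrals, so they
    are equalities almost everywhere. Cancelling [w], which [w_supp] permits, makes [phi] and its
    shift proportional, then of equal mass on [lo]; so [phi] has no mass on the interval from [m] to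
    [m + t], against [phi_pos]. *)
Lemma shifted_mass_lt :
  (\int[leb]_(y in hi) (g y)%:E < \int[leb]_(x in lo) (g x)%:E)%E.
Proof.
rewrite lt_neqAle shifted_mass_le andbT; apply/negP => /eqP eqG.
have [G GE] : exists G, (\int[leb]_(x in lo) (g x)%:E = G%:E)%E.
  exists (fine (\int[leb]_(x in lo) (g x)%:E)); rewrite fineK// ge0_fin_numE//.
  by apply: integral_ge0 => x _; rewrite lee_fin.
have GhE : (\int[leb]_(x in hi) (g x)%:E = G%:E)%E by rewrite eqG.
have G0 : 0 <= G.
  by rewrite -lee_fin -GE; apply: integral_ge0 => x _; rewrite lee_fin.
have cancel_w x : k x * G = g x * K -> phi x * G = phi (x + t) * K.
  rewrite /k /g -!mulrA; have [/w_supp[-> ->]|wx] := eqVneq (w x) 0.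
    by rewrite !mul0r.
  by move/(mulfI wx).
(* An almost everywhere relation between [k] and [g] becomes one between [phi] and its translate,
   and is integrated over [D]. *)
have mass D : measurable D ->
    ae_eq leb D (fun x => (k x * G)%:E) (fun x => (g x * K)%:E) ->
    (\int[leb]_(x in D) (phi x)%:E * G%:E =
     \int[leb]_(x in D) (phi (x + t)%R)%:E * K%:E)%E.
  move=> mD kg.
  rewrite -!ge0_integralZr//; try (by move=> x _; rewrite lee_fin);
    try (exact: mE); rewrite ?lee_fin ?ltW//.
  apply: ge0_ae_eq_integral => //.
  - by apply: emeasurable_funM => //; exact: mE.
  - by apply: emeasurable_funM => //; exact: mE.
  - by move=> x _; rewrite lee_fin mulr_ge0.
  - by move=> x _; rewrite lee_fin mulr_ge0// ltW.
  apply: filterS kg => x kg Dx.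
  by rewrite -!EFinM (@cancel_w x)//; apply: EFin_inj; exact: kg.
have massG D : measurable D -> (\int[leb]_(x in D) (k x)%:E = K%:E)%E ->
    (\int[leb]_(x in D) (g x)%:E = G%:E)%E ->
    (\int[leb]_(x in D) (k x * G)%:E = \int[leb]_(x in D) (g x * K)%:E)%E.
  move=> mD kD gD.
  under eq_integral do rewrite EFinM.
  rewrite ge0_integralZr ?kD ?lee_fin//; [|exact: mE|by move=> x _; rewrite lee_fin].
  under eq_integral do rewrite EFinM.
  rewrite ge0_integralZr ?gD ?lee_fin ?ltW//;
    [|exact: mE|by move=> x _; rewrite lee_fin].
  by rewrite muleC.
have fin D : measurable D ->
    (\int[leb]_(x in D) (g x)%:E = G%:E)%E ->
    (\int[leb]_(x in D) (g x * K)%:E < +oo)%E.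
  move=> mD gD; under eq_integral do rewrite EFinM.
  by rewrite ge0_integralZr ?gD ?lee_fin ?ltW ?ltry//;
    [exact: mE|move=> x _; rewrite lee_fin].
(* Both sides of [lo_le] integrate to [G * K] over [lo]; likewise for [hi_le] over [hi] below. *)
have Elo : (\int[leb]_(x in lo) (phi x)%:E * G%:E =
     \int[leb]_(x in lo) (phi (x + t)%R)%:E * K%:E)%E.
  apply: mass => //; apply: ae_eq_sym; apply: ge0_le_integral_ae_eq => //.
  - by apply: mE; exact: measurable_funM.
  - by apply: mE; exact: measurable_funM.
  - by move=> x _; rewrite lee_fin mulr_ge0.
  - by move=> x xl; rewrite !EFinM -GhE; apply: lo_le; rewrite inE.
  - exact: fin.
  - exact: massG.
have Ehi : (\int[leb]_(x in hi) (phi x)%:E * G%:E =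
     \int[leb]_(x in hi) (phi (x + t)%R)%:E * K%:E)%E.
  apply: mass => //; apply: ge0_le_integral_ae_eq => //.
  - by apply: mE; exact: measurable_funM.
  - by apply: mE; exact: measurable_funM.
  - by move=> x _; rewrite lee_fin mulr_ge0// ltW.
  - by move=> x xl; rewrite !EFinM -GE; apply: hi_le; rewrite inE.
  - by rewrite massG//; exact: fin.
  - by rewrite massG.
have lohi : lo `|` hi = setT.
  apply/seteqP; split => // x _; rewrite /lo /hi/= !in_itv/= andbT.
  by case: leP => h; [left|right].
have dlohi : [disjoint lo & hi].
  apply/disj_set2P/seteqP; split => // x; rewrite /lo /hi/= !in_itv/= andbT.
  by case=> xm; rewrite ltNge xm.
have split (h : R -> R) : measurable_fun setT h -> (forall x, 0 <= h x) ->
    (\int[leb]_(x in lo) (h x)%:E + \int[leb]_(x in hi) (h x)%:E =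
     \int[leb]_x (h x)%:E)%E.
  move=> mh h0; rewrite -ge0_integral_setU ?lohi//.
  + exact/measurable_EFinP.
  + by move=> x _; rewrite lee_fin.
have phit1 : (\int[leb]_x (phi (x + t)%R)%:E = 1)%E.
  rewrite -phi1; apply: (@ge0_integral_shift _ t (EFin \o phi)).
    exact/measurable_EFinP.
  by move=> x; rewrite /= lee_fin.
have I0 D (h : R -> R) : (forall x, 0 <= h x) ->
    (0 <= \int[leb]_(x in D) (h x)%:E)%E.
  by move=> h0; apply: integral_ge0 => x _; rewrite lee_fin.
(* Adding the identities over lo and hi leaves the total mass 1 of phi on both
   sides, hence G = K. *)
have GK : G = K.
  have : ((\int[leb]_(x in lo) (phi x)%:E + \int[leb]_(x in hi) (phi x)%:E) * G%:E =
      (\int[leb]_(x in lo) (phi (x + t)%R)%:E +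
       \int[leb]_(x in hi) (phi (x + t)%R)%:E) * K%:E)%E.
    by rewrite ge0_muleDl ?I0// [RHS]ge0_muleDl ?I0// Elo Ehi.
  by rewrite !split// phi1 phit1 !mul1e => -[].
have Klo : (\int[leb]_(x in lo) (phi x)%:E =
     \int[leb]_(x in lo) (phi (x + t)%R)%:E)%E.
  by apply/eqP; rewrite eq_le; apply/andP; split;
    rewrite -(@lee_pmul2r _ K%:E) ?lte_fin// -Elo GK lexx.
have lotE : lo = [set x | [set` `]-oo, m + t]] (x + t)].
  by apply/seteqP; split => x; rewrite /lo/= !in_itv/= lerD2r.
(* Translating by [t] turns [lo] into the half-line up to [m + t], which exceeds [lo] by the
   interval from [m] to [m + t]. *)
have : (\int[leb]_(x in lo) (phi (x + t)%R)%:E = \int[leb]_(x in lo) (phi x)%:E +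
    \int[leb]_(x in `]m, (m + t)%R]) (phi x)%:E)%E.
  rewrite {1}lotE (@ge0_integral_shift_preimage _ t _ (EFin \o phi))//=; last 2 first.
    exact: mE.
    by move=> x _; rewrite lee_fin.
  rewrite -ge0_integral_setU//.
  - congr (integral _ _ _); apply/seteqP; split => x; rewrite /lo/= !in_itv/=.
      by move=> xmt; case: (leP x m) => h; [left|right].
    by case=> [xm|/andP[]//]; rewrite (le_trans xm)// lerDl ltW.
  - exact: mE.
  - by move=> x _; rewrite lee_fin.
  - apply/disj_set2P/seteqP; split => // x; rewrite /lo/= !in_itv/=.
    by case=> xm /andP[]; rewrite ltNge xm.
have philo : (\int[leb]_(x in lo) (phi x)%:E)%E \is a fin_num.
  rewrite ge0_fin_numE; last by apply: integral_ge0 => x _; rewrite lee_fin.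
  apply: (@le_lt_trans _ _ 1%E); last exact: ltry.
  rewrite -phi1; apply: ge0_subset_integral => //; first exact: mE.
  by move=> x _; rewrite lee_fin.
(* Positivity of [phi] is known only up to [m + e], hence the length [Num.min t e]. *)
have Ipos : (0 < \int[leb]_(x in `]m, (m + t)%R]) (phi x)%:E)%E.
  apply: (@lt_le_trans _ _
      (\int[leb]_(x in `]m, (m + Num.min t e)%R[) (phi x)%:E)%E).
    apply: integral_itvoo_gt0 => //; first by rewrite ltrDl lt_min t0.
    move=> x mx xm; apply: phi_pos => //; apply: lt_le_trans xm _.
    by rewrite lerD2l ge_min lexx orbT.
  apply: ge0_subset_integral => //; first exact: mE.
    by move=> x _; rewrite lee_fin.
  move=> x; rewrite /= !in_itv/= => /andP[-> /ltW xm]/=; apply: le_trans xm _.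
  by rewrite lerD2l ge_min lexx.
rewrite -Klo => /esym/eqP; apply/negP; rewrite gt_eqF//.
by rewrite lteDl.
Qed.
End ratio.

(** * Joint law of the maximum and the spread *)

Section pair_density.
Context d (T : measurableType d) (R : realType) (P : probability T R).
Variables (X Y : {mfun T >-> R}) (g1 g2 : R -> R).
Hypotheses (mg1 : measurable_fun setT g1) (g1_ge0 : forall x, 0 <= g1 x).
Hypotheses (mg2 : measurable_fun setT g2) (g2_ge0 : forall x, 0 <= g2 x).
Hypotheses (XY : indep2 P X Y).
Hypotheses (dX : has_density P X g1) (dY : has_density P Y g2).
Local Notation leb := (@lebesgue_measure R).

Let h (z : R * R) := g1 z.1 * g2 z.2.
Let mh : measurable_fun setT h.
Proof. by apply: measurable_funM; exact: measurableT_comp. Qed.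
Let h0 z : 0 <= h z. Proof. exact: mulr_ge0. Qed.

Let integral_restrict (E : set (R * R)) : measurable E ->
  (\int[leb \x leb]_(z in E) (h z)%:E =
   \int[leb]_x \int[leb]_y (\1_E (x, y) * (g1 x * g2 y))%:E)%E.
Proof.
move=> mE; rewrite integral_mkcond fubini_tonelli1/=; last 2 first.
- by apply/(measurable_restrictT _ mE)/measurable_funTS/measurable_EFinP.
- by apply: erestrict_ge0 => z _; rewrite lee_fin.
apply: eq_integral => x _; apply: eq_integral => y _.
rewrite patchE indicE; case: ifP => _; first by rewrite mul1r.
by rewrite mul0r.
Qed.

(** The measure on the plane with density [h]; being a measure, it can be compared with product
    measures on rectangles alone. *)
Let nu (A : set (R * R)) : \bar R := (\int[leb \x leb]_(z in A) (h z)%:E)%E.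
Let nu0 : nu set0 = 0%E. Proof. by rewrite /nu integral_set0. Qed.
Let nu_ge0 A : (0 <= nu A)%E.
Proof. by apply: integral_ge0 => x _; rewrite lee_fin. Qed.
Let nu_sigma : semi_sigma_additive nu.
Proof.
have := @semi_sigma_additive_nng_induced _ _ R (leb \x leb)%E (EFin \o h).
apply; first exact/measurable_EFinP.
by move=> x; rewrite lee_fin.
Qed.

(** The product of the two marginal laws agrees on rectangles with [nu] by Tonelli, and with the
    joint law by independence. Uniqueness of the product measure identifies all three. *)
Lemma indep_density_pair (E : set (R * R)) : measurable E ->
  (P [set w | E (X w, Y w)] =
   \int[leb]_x \int[leb]_y (\1_E (x, y) * (g1 x * g2 y))%:E)%E.
Proof.
move=> mE.
have mXY : measurable_fun setT (fun w => (X w, Y w)) by exact: measurable_fun_pair.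
pose sXY := isMeasurableFun.Build _ _ _ _ _ mXY.
pose XYf : {mfun T >-> (R * R)%type} := HB.pack (fun w => (X w, Y w)) sXY.
pose mnu := isMeasure.Build _ (R * R)%type _ nu nu0 nu_ge0 nu_sigma.
pose snu : {measure set (R * R)%type -> \bar R} := HB.pack nu mnu.
have prodnu A : measurable A -> (distribution P X \x distribution P Y)%E A = nu A.
  apply: (@product_measure_unique _ _ _ _ _ _ _ snu) => A1 A2 mA1 mA2.
  rewrite /snu/= /nu integral_restrict; last exact: measurableX.
  rewrite /distribution/= /pushforward dX// dY//.
  have restr (B : set R) (g : R -> R) : measurable B -> measurable_fun setT g ->
      (forall x, 0 <= g x) ->
      [/\ (\int[leb]_(x in B) (g x)%:E = \int[leb]_x (\1_B x * g x)%:E)%E,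
          measurable_fun setT (fun x : R => (\1_B x * g x)%:E)
        & forall x, (0 <= (\1_B x * g x)%:E)%E].
    move=> mA mg g0; split.
    - rewrite integral_mkcond; apply: eq_integral => x _.
      by rewrite patchE indicE; case: ifP => _; rewrite ?mul1r ?mul0r.
    - apply/measurable_EFinP; apply: measurable_funM => //.
    - by move=> x; rewrite lee_fin mulr_ge0.
  have [-> mr1 r1] := restr A1 g1 mA1 mg1 g1_ge0.
  have [-> mr2 r2] := restr A2 g2 mA2 mg2 g2_ge0.
  rewrite -ge0_integralZr//; last by apply: integral_ge0 => x _; exact: r2.
  apply: eq_integral => x _; rewrite -ge0_integralZl//.
  apply: eq_integral => y _; rewrite -EFinM; congr EFin.
  by rewrite !indicE in_setX/=; case: (x \in A1); case: (y \in A2);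
    rewrite ?(mul0r, mulr0, mul1r).
have prodXY A : measurable A ->
    (distribution P X \x distribution P Y)%E A = distribution P XYf A.
  apply: product_measure_unique => A1 A2 mA1 mA2.
  by rewrite /distribution/= /pushforward -XY.
by rewrite -integral_restrict// -/(nu E) -prodnu// prodXY.
Qed.
End pair_density.

Section change_of_coordinates.
Context {R : realType}.
Local Notation leb := (@lebesgue_measure R).

(** For fixed [x] substitute [y = x - u], exchange the integrals, then substitute [x = z + b]. With
    [b] the larger parameter and [x] the larger observation, [z] and [u] are the centred maximum and
    the spread. *)
Lemma ge0_integral_max_spread (b : R) (H : R * R -> \bar R) :
  measurable_fun setT H -> (forall p, 0 <= H p)%E ->
  (\int[leb]_x \int[leb]_y H (x, y) =
   \int[leb]_u \int[leb]_z H ((z + b)%R, (z + b - u)%R))%E.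
Proof.
move=> mH H0.
have mH2 : measurable_fun setT (fun p : R * R => H (p.1, p.1 - p.2)).
  apply: (@measurableT_comp _ _ _ _ _ _ H) => //.
  by apply: measurable_fun_pair => //; exact: measurable_funB.
transitivity (\int[leb]_x \int[leb]_u H (x, (x - u)%R))%E.
  apply: eq_integral => x _; rewrite -[LHS](@ge0_integral_reflect _ x)//.
  exact: (measurable_fun_pair2 x mH).
have /= -> := @fubini_tonelli _ _ _ _ R leb leb _ mH2 (fun p => H0 _).
apply: eq_integral => u _; rewrite -[LHS](@ge0_integral_shift _ b)//.
exact: (measurable_fun_pair1 u mH2).
Qed.

Lemma ge0_iterated_integralD (H1 H2 : R * R -> \bar R) :
  measurable_fun setT H1 -> (forall p, 0 <= H1 p)%E ->
  measurable_fun setT H2 -> (forall p, 0 <= H2 p)%E ->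
  (\int[leb]_x \int[leb]_y (H1 (x, y) + H2 (x, y)) =
   \int[leb]_x \int[leb]_y H1 (x, y) + \int[leb]_x \int[leb]_y H2 (x, y))%E.
Proof.
move=> mH1 H10 mH2 H20; rewrite -ge0_integralD//; last 4 first.
- by move=> x _; exact: integral_ge0.
- exact: (measurable_fun_fubini_tonelli_F (m2 := leb) H1).
- by move=> x _; exact: integral_ge0.
- exact: (measurable_fun_fubini_tonelli_F (m2 := leb) H2).
apply: eq_integral => x _; rewrite ge0_integralD//.
- exact: (measurable_fun_pair2 x mH1).
- exact: (measurable_fun_pair2 x mH2).
Qed.

End change_of_coordinates.

Section spread_law.
Context (R : realType) (d : measure_display) (T : measurableType d).
Variables (f : R -> R) (P : R * R -> probability T R) (X1 X2 : {mfun T >-> R}).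
Hypotheses (hf : is_density f) (hmodel : location_model f P X1 X2).
Local Notation leb := (@lebesgue_measure R).

Let mf : measurable_fun setT f. Proof. by case: hf. Qed.
Let f0 x : 0 <= f x. Proof. by case: hf. Qed.

Let mfB (a : R) : measurable_fun setT (fun x : R => f (x - a)).
Proof.
by apply: (@measurableT_comp _ _ _ _ _ _ f) => //; exact: measurable_funB.
Qed.

Lemma cond_weight_ge0 th u z : 0 <= cond_weight f th u z.
Proof. by rewrite /cond_weight addr_ge0// mulr_ge0. Qed.

Lemma measurable_cond_weight th :
  measurable_fun setT (fun p : R * R => cond_weight f th p.2 p.1).
Proof.
have mshift (h : R * R -> R) : measurable_fun setT h ->
    measurable_fun setT (fun p => f (h p)).
  by move=> mh; exact: measurableT_comp.
rewrite /cond_weight; apply: measurable_funD; apply: measurable_funM;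
  apply: mshift; rewrite //.
- by apply: measurable_funD => //; exact: measurable_funB.
- exact: measurable_funB.
- exact: measurable_funD.
Qed.

(** On positive spreads [cond_weight] is the joint density of the centred maximum and the spread.
    Its two summands come from the two possibilities for which observation is the larger. *)
Lemma spread_law (th : R * R) (S : set (R * R)) : measurable S ->
  (P th [set w | (0 < spread (X1 w, X2 w))%R /\
                 S ((ord2 (X1 w, X2 w) - ord2 th)%R, spread (X1 w, X2 w))] =
   \int[leb]_(u in `]0%R, +oo[)
     \int[leb]_z (\1_S (z, u) * cond_weight f th u z)%:E)%E.
Proof.
move=> mS; have [ind d1 d2] := hmodel th.
pose b := ord2 th.
(* The part of the event where the first coordinate is strictly larger; the other part is its mirror
   image, ties being excluded by the positive spread. *)
pose E1 : set (R * R) := [set p | p.2 < p.1] `&` [set p | S (p.1 - b, p.1 - p.2)].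
have mE1 : measurable E1.
  apply: measurableI.
    rewrite -[X in measurable X]setTI.
    by apply: (measurable_fun_ltr measurable_snd measurable_fst) => //.
  rewrite -[X in measurable X]setTI.
  apply: (@measurable_fun_pair _ _ _ _ _ _
    (fun p : R * R => p.1 - b) (fun p => p.1 - p.2)) => //.
    exact: measurable_funB.
  exact: measurable_funB.
pose E : set (R * R) := E1 `|` [set p | E1 (p.2, p.1)].
have mE : measurable E.
  apply: measurableU => //.
  by rewrite -[X in measurable X]setTI; exact: measurable_swap.
rewrite (_ : [set w | _] = [set w | E (X1 w, X2 w)]); last first.
  apply/seteqP; split => w; rewrite /E /E1 /spread /Defs.ord1 /ord2 /=;
    case: (ltgtP (X1 w) (X2 w)) => //.
  - by move=> _ [_ ?]; right.
  - by move=> _ [_ ?]; left.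
  - by move=> ->; rewrite subrr ltxx => -[].
  - by move=> X12 [[]//|[]//]; rewrite subr_gt0.
  - by move=> X12 [[]//|[]//]; rewrite subr_gt0.
  - by move=> _ [[]|[]].
rewrite (indep_density_pair (mfB th.1) _ (mfB th.2) _ ind d1 d2)//.
pose g1 x := f (x - th.1); pose g2 x := f (x - th.2).
have mF (g g' : R -> R) : measurable_fun setT g -> measurable_fun setT g' ->
    measurable_fun setT (fun p : R * R => (\1_E1 p * (g p.1 * g' p.2))%:E).
  move=> mg mg'; apply/measurable_EFinP; apply: measurable_funM.
    exact: measurable_indic.
  by apply: measurable_funM; exact: measurableT_comp.
have F0 (g g' : R -> R) : (forall x, 0 <= g x) -> (forall x, 0 <= g' x) -> 
    forall p, (0 <= (\1_E1 p * (g p.1 * g' p.2))%:E)%E.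
  by move=> g0 g'0 p; rewrite lee_fin !mulr_ge0.
transitivity (\int[leb]_x \int[leb]_y (\1_E1 (x, y) * (g1 x * g2 y))%:E +
    \int[leb]_y \int[leb]_x (\1_E1 (y, x) * (g2 y * g1 x))%:E)%E.
  (* In the mirrored half the integrals are exchanged, so that its outer variable is again the
     maximum. *)
  have /= -> := @fubini_tonelli _ _ _ _ R leb leb _
    (mF g2 g1 (mfB _) (mfB _)) (F0 g2 g1 (fun=> f0 _) (fun=> f0 _)).
  have mswap : measurable_fun setT
      (fun p : R * R => (\1_E1 (p.2, p.1) * (g2 p.2 * g1 p.1))%:E).
    exact: (measurableT_comp (mF g2 g1 (mfB _) (mfB _))
      (measurable_fun_pair measurable_snd measurable_fst)).
  have /= <- := ge0_iterated_integralD (mF g1 g2 (mfB _) (mfB _))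
    (F0 g1 g2 (fun=> f0 _) (fun=> f0 _)) mswap
    (fun p => F0 g2 g1 (fun=> f0 _) (fun=> f0 _) (p.2, p.1)).
  apply: eq_integral => x _; apply: eq_integral => y _.
  rewrite -EFinD; congr EFin; rewrite !indicE.
  rewrite (_ : ((x, y) \in E) = ((x, y) \in E1) || ((y, x) \in E1)); last first.
    by apply/idP/orP => [/set_mem[] ?|[] /set_mem ?];
      [left; exact: mem_set|right; exact: mem_set|
       apply: mem_set; left|apply: mem_set; right].
  (* The two halves are disjoint, so their indicators add up to that of [E]. *)
  have [/set_mem[/= yx _]|_] := boolP ((x, y) \in E1); last first.
    by rewrite mul0r add0r (mulrC (f _)).
  rewrite memNset ?mul0r ?addr0//= => -[/= xy _].
  by have := lt_trans yx xy; rewrite ltxx.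
have Hmax (g g' : R -> R) : measurable_fun setT g -> measurable_fun setT g' ->
    (forall x, 0 <= g x) -> (forall x, 0 <= g' x) ->
    let H p := (\1_E1 (p.2 + b, p.2 + b - p.1) *
                (g (p.2 + b) * g' (p.2 + b - p.1)))%:E in
    [/\ measurable_fun setT H, (forall p, 0 <= H p)%E &
    (\int[leb]_x \int[leb]_y (\1_E1 (x, y) * (g x * g' y))%:E =
     \int[leb]_u \int[leb]_z H (u, z))%E].
  move=> mg mg' g0 g'0 H; split.
  - have mc : measurable_fun setT (fun p : R * R => (p.2 + b, p.2 + b - p.1)).
      apply: measurable_fun_pair; first exact: measurable_funD.
      by apply: measurable_funB => //; exact: measurable_funD.
    exact: (measurableT_comp (mF g g' mg mg') mc).
  - by move=> p; exact: (F0 g g').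
  - exact: (ge0_integral_max_spread b (mF g g' mg mg') (F0 g g' g0 g'0)).
have [mH1 H10 ->] := Hmax g1 g2 (mfB _) (mfB _) (fun=> f0 _) (fun=> f0 _).
have [mH2 H20 ->] := Hmax g2 g1 (mfB _) (mfB _) (fun=> f0 _) (fun=> f0 _).
have /= <- := ge0_iterated_integralD mH1 H10 mH2 H20.
rewrite [RHS]integral_mkcond; apply: eq_integral => u _.
rewrite patchE; case: ifPn => [|u0].
  rewrite inE/= in_itv/= andbT => u0; apply: eq_integral => z _.
  have -> : \1_E1 (z + b, z + b - u) = \1_S (z, u) :> R.
    rewrite !indicE; congr (_%:R); congr nat_of_bool; apply/idP/idP => /set_mem.
      by case=> _ /=; rewrite addrK opprB addrC subrK => /mem_set.
    move=> Szu; apply/mem_set; split => /=; first by rewrite gtrBl.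
    by rewrite addrK opprB addrC subrK.
  rewrite -EFinD -mulrDr; congr (_ * _)%:E.
  rewrite /g1 /g2 /cond_weight /b /spread /Defs.ord1 /ord2.
  (* The order of the parameters decides which half yields which summand. *)
  case: (leP th.1 th.2) => _; last first.
    by congr (_ + _); rewrite mulrC; congr (f _ * f _); ring.
  by rewrite [RHS]addrC; congr (_ + _); rewrite mulrC; congr (f _ * f _); ring.
(* For [u <= 0] the point lies outside [E1], which requires [z + b - u < z + b]. *)
rewrite integral0_eq// => z _; rewrite !indicE memNset ?mul0r ?adde0//.
move=> [/= + _]; rewrite gtrBl => u_gt0; move/negP: u0; apply.
by rewrite inE /= in_itv/= u_gt0.
Qed.
End spread_law.

(** * The null conditional median *)

Section median.
Context (R : realType).
Variable f : R -> R.
Hypothesis hf : is_density f.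
Hypothesis hmed : forall u : R, 0 < u ->
  exists! m, is_median (cond_law f (0%R, 0%R) u) m.
Local Notation leb := (@lebesgue_measure R).
Local Notation med := (cond_median f (0, 0)).

Let mf : measurable_fun setT f. Proof. by case: hf. Qed.
Let f0 x : 0 <= f x. Proof. by case: hf. Qed.

(** Half the null weight: at the zero parameter both summands of [cond_weight] coincide. *)
Let k u z := f (z - u) * f z.
Let k0 u z : 0 <= k u z. Proof. exact: mulr_ge0. Qed.
Let mk2 : measurable_fun setT (fun p : R * R => k p.1 p.2).
Proof.
apply: measurable_funM; last exact: measurableT_comp.
apply: measurableT_comp => //; exact: measurable_funB.
Qed.
Let mk u : measurable_fun setT (k u).
Proof. exact: (measurable_fun_pair2 u mk2). Qed.
Let mkE u D : measurable_fun D (fun z : R => (k u z)%:E).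
Proof. by apply: measurable_funTS; exact/measurable_EFinP. Qed.

Let weight0E u z : cond_weight f (0%R, 0%R) u z = 2 * k u z.
Proof.
rewrite /cond_weight /spread /Defs.ord1 /ord2/= maxxx minxx subrr !addr0 /k.
by rewrite mulrDl mul1r.
Qed.

Let law0 u A : (0 <= cond_law f (0%R, 0%R) u A)%E.
Proof.
apply: integral_ge0 => z _; rewrite lee_fin /cond_density divr_ge0//.
  exact: cond_weight_ge0.
by apply: Rintegral_ge0 => x _; exact: cond_weight_ge0.
Qed.

(** If the total weight were 0 or infinite, the default values of [Rintegral] and of division would
    make [cond_law] vanish, leaving no median. So [hmed] forces a finite positive mass. *)
Let law_mass u : 0 < u -> exists2 N : R, 0 < N &
  (forall A, measurable A ->
    (\int[leb]_(z in A) (k u z)%:E = N%:E * cond_law f (0%R, 0%R) u A)%E) /\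
  (\int[leb]_z (k u z)%:E = N%:E)%E.
Proof.
move=> u0; pose N := Rintegral leb setT (cond_weight f (0%R, 0%R) u).
have [m [[lom _] _]] := hmed u0.
have N0 : 0 <= N by apply: Rintegral_ge0 => x _; exact: cond_weight_ge0.
have Ngt0 : 0 < N.
  rewrite lt0r N0 andbT; apply/negP => /eqP N00; move: lom.
  rewrite /cond_law integral0_eq ?lee_fin ?leNgt ?invr_gt0 ?ltr0n// => z _.
  by rewrite /cond_density -/N N00 invr0 mulr0.
have mw : measurable_fun setT (fun z : R => (cond_weight f (0%R, 0%R) u z)%:E).
  apply/measurable_EFinP.
  exact: (measurable_fun_pair1 u (measurable_cond_weight hf (0, 0))).
have intw : (\int[leb]_z (cond_weight f (0%R, 0%R) u z)%:E = N%:E)%E.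
  move: Ngt0; rewrite /N /Rintegral; case: (integral _ _ _) => //=;
    by rewrite ltxx.
have intk : (\int[leb]_z (k u z)%:E = (N / 2)%:E)%E.
  rewrite EFinM muleC -intw -ge0_integralZl//; last first.
    by move=> z _; rewrite lee_fin; exact: cond_weight_ge0.
  by apply: eq_integral => z _; rewrite -EFinM weight0E mulKf.
exists (N / 2); first by rewrite divr_gt0.
split=> // A mA; rewrite -ge0_integralZl//; last 3 first.
- apply/measurable_EFinP; apply: measurable_funM => //.
  by apply: measurable_funTS; exact/measurable_EFinP.
- by move=> z _; rewrite lee_fin /cond_density divr_ge0//; exact: cond_weight_ge0.
- by rewrite lee_fin divr_ge0.
apply: eq_integral => z _; rewrite -EFinM /cond_density -/N weight0E.
by congr EFin; field; rewrite gt_eqF.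
Qed.

Lemma pair_mass_gt0 u : 0 < u -> (0 < \int[leb]_z (f (z - u)%R * f z)%:E)%E.
Proof. by move=> /law_mass[N N0 [_ ->]]; rewrite lte_fin. Qed.

Lemma pair_mass_lty u : 0 < u -> (\int[leb]_z (f (z - u)%R * f z)%:E < +oo)%E.
Proof. by move=> /law_mass[N N0 [_ ->]]; rewrite ltry. Qed.

Let lohi u c : (\int[leb]_z (k u z)%:E =
  \int[leb]_(z in `]-oo, c]) (k u z)%:E + \int[leb]_(z in `]c, +oo[) (k u z)%:E)%E.
Proof.
have -> : [set: R] = [set` `]-oo, c]] `|` [set` `]c, +oo[].
  apply/seteqP; split => // x _ /=.
  by rewrite !in_itv/= andbT; case: (leP x c) => ?; [left|right].
rewrite ge0_integral_setU//.
- exact: mkE.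
- by move=> x _; rewrite lee_fin.
- apply/disj_set2P/seteqP; split => // x; rewrite /= !in_itv/= andbT.
  by case=> xm; rewrite ltNge xm.
Qed.

(** Points are null, so the closed upper half-line can be opened. The two masses then have a finite
    sum, and both reach half of it exactly when they are equal. *)
Let medianP u c : 0 < u -> is_median (cond_law f (0%R, 0%R) u) c <->
  (\int[leb]_(z in `]-oo, c]) (k u z)%:E = \int[leb]_(z in `]c, +oo[) (k u z)%:E)%E.
Proof.
move=> u0; have [N N0 [lawE kN]] := law_mass u0.
have lowE : is_median (cond_law f (0%R, 0%R) u) c <->
   ((N / 2)%:E <= \int[leb]_(z in `]-oo, c]) (k u z)%:E)%E /\
   ((N / 2)%:E <= \int[leb]_(z in `]c, +oo[) (k u z)%:E)%E.
  rewrite integral_itv_obnd_cbnd// !lawE//= EFinM !lee_pmul2l ?lte_fin//.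
rewrite lowE; have := lohi u c; rewrite kN.
have : (0 <= \int[leb]_(z in `]-oo, c]) (k u z)%:E)%E.
  by apply: integral_ge0 => x _; rewrite lee_fin.
have : (0 <= \int[leb]_(z in `]c, +oo[) (k u z)%:E)%E.
  by apply: integral_ge0 => x _; rewrite lee_fin.
move: (integral _ _ _) (integral _ _ _) => [a| |] [b| |]//=.
rewrite -EFinD !lee_fin => _ _ [NE].
split=> [[Na Nb]|[ab]]; first by congr EFin; lra.
by rewrite ab in NE *; split; lra.
Qed.

Lemma cond_median_half u : 0 < u -> exists2 K : R, 0 < K &
  (\int[leb]_(z in `]-oo, med u]) (f (z - u)%R * f z)%:E = K%:E)%E /\
  (\int[leb]_(z in `]med u, +oo[) (f (z - u)%R * f z)%:E = K%:E)%E.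
Proof.
move=> u0; have [m [mm _]] := hmed u0.
have : is_median (cond_law f (0%R, 0%R) u) (med u).
  by apply: xgetPex; exists m.
rewrite medianP// => eqlh.
have [N N0 [_ kN]] := law_mass u0.
have := lohi u (med u); rewrite kN -eqlh.
case loE : (integral _ _ _) => [a| |]// [NE].
by exists a; [lra | split=> //; rewrite -loE eqlh].
Qed.

(** This turns a bound on the median into a comparison of integrals, measurable in [u]. For the
    converse, if [c] were below the median, monotonicity would squeeze both masses at [c] to [K],
    making [c] a second median. *)
Lemma cond_median_le u c : 0 < u -> med u <= c <->
  (\int[leb]_(z in `]c, +oo[) (f (z - u)%R * f z)%:E <=
   \int[leb]_(z in `]-oo, c]) (f (z - u)%R * f z)%:E)%E.
Proof.
move=> u0; have [K K0 [klo khi]] := cond_median_half u0.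
have sub (A B : set R) : measurable A -> measurable B -> A `<=` B ->
   (\int[leb]_(z in A) (k u z)%:E <= \int[leb]_(z in B) (k u z)%:E)%E.
  move=> mA mB AB; apply: ge0_subset_integral => //; first exact: mkE.
  by move=> x _; rewrite lee_fin.
split=> [mc|le_hilo].
  apply: (@le_trans _ _ K%:E).
    rewrite -khi; apply: sub => // x; rewrite /= !in_itv/= !andbT.
    exact: le_lt_trans.
  rewrite -klo; apply: sub => // x; rewrite /= !in_itv/= => xm.
  exact: le_trans mc.
rewrite leNgt; apply/negP => cm.
have loK : (\int[leb]_(z in `]-oo, c]) (k u z)%:E <= K%:E)%E.
  rewrite -klo; apply: sub => // x; rewrite /= !in_itv/= => xm.
  exact: le_trans (ltW cm).
have hiK : (K%:E <= \int[leb]_(z in `]c, +oo[) (k u z)%:E)%E.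
  rewrite -khi; apply: sub => // x; rewrite /= !in_itv/= !andbT.
  exact: lt_trans cm.
have cmed : is_median (cond_law f (0%R, 0%R) u) c.
  apply/medianP => //; apply/eqP; rewrite eq_le (le_trans loK hiK)/=.
  exact: le_hilo.
have [m [mm uniq_m]] := hmed u0.
have : is_median (cond_law f (0%R, 0%R) u) (med u) by apply: xgetPex; exists m.
by move=> /uniq_m mE; move: cm; rewrite -mE (uniq_m _ cmed) ltxx.
Qed.

(** The set where the median exceeds [c] is the set where the mass above [c] exceeds the mass below,
    and both masses are measurable in [u] by Tonelli. The value 0 is put where [hmed] says
    nothing. *)
Lemma measurable_cond_median :
  measurable_fun setT (fun u : R => if 0 < u then med u else 0).
Proof.
apply: measurable_fun_if => //; first exact: measurable_fun_ltr.
  rewrite setTI.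
  apply: (measurability (@RGenOInfty.G R)).
    exact: RGenOInfty.measurableE.
  move=> /= _ [_ [c ->] <-].
  rewrite [X in measurable X](_ : _ = [set` `]0, +oo[] `&` [set u |
    (\int[leb]_z (\1_[set` `]-oo, c]] z * k u z)%:E <
     \int[leb]_z (\1_[set` `]c, +oo[] z * k u z)%:E)%E]); last first.
    have patch u D : (\int[leb]_z (\1_D z * k u z)%:E =
        \int[leb]_(z in D) (f (z - u)%R * f z)%:E)%E.
      rewrite [RHS]integral_mkcond; apply: eq_integral => z _.
      by rewrite patchE indicE; case: ifP => _; rewrite ?mul1r ?mul0r.
    apply/seteqP; split => u /=; rewrite !in_itv/= ?andbT !patch => -[u0].
      rewrite ltNge => /negP mc; split => //.
      by rewrite ltNge; apply/negP => /(cond_median_le _ u0).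
    rewrite ltNge => /negP mc; split => //.
    by rewrite ltNge; apply/negP => /(cond_median_le _ u0).
  have mI D : measurable D ->
      measurable_fun setT (fun u : R => \int[leb]_z (\1_D z * k u z)%:E)%E.
    move=> mD.
    apply: (measurable_fun_fubini_tonelli_F (m2 := leb)
      (fun p : R * R => (\1_D p.2 * k p.1 p.2)%:E)).
      apply/measurable_EFinP; apply: measurable_funM => //.
      by apply: measurableT_comp => //; exact: measurable_indic.
    by move=> p; rewrite lee_fin mulr_ge0.
  by apply: measurable_lte => //; apply: measurable_funTS; exact: mI.
Qed.

End median.

(** * Conditional weights under MLR *)

Section support.
Context (R : realType).
Variable f : R -> R.
Hypothesis f0 : forall x, 0 <= f x.
Hypothesis hMLR : MLR f.

(** This is MLR with parameters [- t] and [0], in the form of [phi_lr]. *)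
Lemma MLR_shift t x y : 0 <= t -> x < y -> f x * f (y + t) <= f (x + t) * f y.
Proof.
rewrite le_eqVlt => /predU1P[<-|t0] xy; first by rewrite !addr0.
have := hMLR xy (_ : - t < 0); rewrite !subr0 !opprK; apply.
by rewrite oppr_lt0.
Qed.

(** Shifting by [y - x] gives [f x * f z <= f y * f (z - (y - x))], whose left side is positive. *)
Lemma MLR_support_convex x y z : x < y -> y < z -> 0 < f x -> 0 < f z -> 0 < f y.
Proof.
move=> xy yz fx fz.
have H : f x * f (z - (y - x) + (y - x)) <= f (x + (y - x)) * f (z - (y - x)).
  by apply: MLR_shift; lra.
rewrite lt0r f0 andbT; apply/eqP => fy0; move: H.
rewrite subrK (_ : x + (y - x) = y) ?fy0 ?mul0r; last by ring.
by rewrite leNgt mulr_gt0.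
Qed.

Lemma left_unbounded_support : (forall M, exists2 x, x < M & 0 < f x) ->
  forall x y, x < y -> 0 < f y -> 0 < f x.
Proof.
move=> unb x y xy fy; have [x' x'x fx'] := unb x.
exact: MLR_support_convex x'x xy fx' fy.
Qed.

Lemma right_unbounded_support : (forall M, exists2 x, M < x & 0 < f x) ->
  forall x y, x < y -> 0 < f x -> 0 < f y.
Proof.
move=> unb x y xy fx; have [y' yy' fy'] := unb y.
exact: MLR_support_convex xy yy' fx fy'.
Qed.

End support.

Section cond_weight_median.
Context (R : realType).
Variable f : R -> R.
Hypothesis hf : is_density f.
Hypothesis hMLR : MLR f.
Hypothesis hmed : forall u : R, 0 < u ->
  exists! m, is_median (cond_law f (0, 0) u) m.
Local Notation leb := (@lebesgue_measure R).
Local Notation med := (cond_median f (0, 0)).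

Let mf : measurable_fun setT f. Proof. by case: hf. Qed.
Let f0 x : 0 <= f x. Proof. by case: hf. Qed.
Let mfB (a : R) : measurable_fun setT (fun x : R => f (x - a)).
Proof.
by apply: (@measurableT_comp _ _ _ _ _ _ f) => //; exact: measurable_funB.
Qed.
Let mfD (a : R) : measurable_fun setT (fun x : R => f (x + a)).
Proof.
by apply: (@measurableT_comp _ _ _ _ _ _ f) => //; exact: measurable_funD.
Qed.

(** Were the support contained in [[M1, M2]], a spread [u > M2 - M1] would make [f (z - u) * f z]
    vanish identically, against [pair_mass_gt0]. The maximum with 1 keeps [u] positive. *)
Lemma unbounded_support :
  (forall M, exists2 x, x < M & 0 < f x) \/ (forall M, exists2 x, M < x & 0 < f x).
Proof.
apply: contrapT => /not_orP[/existsNP[M1 H1] /existsNP[M2 H2]].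
have u0 : 0 < Num.max 1 (M2 - M1 + 1) by rewrite lt_max ltr01.
have := pair_mass_gt0 hf hmed u0; rewrite integral0_eq ?ltxx// => z _.
have fz0 x : ~ 0 < f x -> f x = 0.
  by move=> /negP; rewrite -leNgt => fx; apply/le_anti; rewrite fx f0.
congr EFin; have [zM|Mz] := leP z M2; last first.
  by rewrite (fz0 z) ?mulr0// => fz; apply: H2; exists z.
rewrite (fz0 (z - _)) ?mul0r// => fz; apply: H1.
exists (z - Num.max 1 (M2 - M1 + 1)) => //.
have : M2 - M1 + 1 <= Num.max 1 (M2 - M1 + 1) by rewrite le_max lexx orbT.
lra.
Qed.

Variables (th : R * R) (u : R).
Hypothesis u0 : 0 < u.
Let t := spread th.
Let t0 : 0 <= t.
Proof. by rewrite /t /spread /Defs.ord1 /ord2 subr_ge0 ge_min le_max lexx. Qed.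
Let m := med u.
(** The two summands of [cond_weight] as products [w z * phi (z + t)]: [g1] with [w] equal to [f]
    and [phi] its translate by [u], [g2] with the roles exchanged. *)
Let g1 z := f z * f (z + t - u).
Let g2 z := f (z - u) * f (z + t).
Let g1_ge0 z : 0 <= g1 z. Proof. exact: mulr_ge0. Qed.
Let g2_ge0 z : 0 <= g2 z. Proof. exact: mulr_ge0. Qed.
Let mg1 : measurable_fun setT g1.
Proof.
apply: measurable_funM => //; apply: (@measurableT_comp _ _ _ _ _ _ f) => //.
by apply: measurable_funB => //; exact: measurable_funD.
Qed.
Let mg2 : measurable_fun setT g2. Proof. exact: measurable_funM. Qed.

Let weightE D : measurable D -> (\int[leb]_(z in D) (cond_weight f th u z)%:E =
  \int[leb]_(z in D) (g1 z)%:E + \int[leb]_(z in D) (g2 z)%:E)%E.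
Proof.
move=> mD; rewrite -ge0_integralD//.
- apply: eq_integral => z _; rewrite -EFinD /cond_weight -/t /g1 /g2.
  by rewrite (mulrC (f z)) (addrAC z t).
- by move=> z _; rewrite lee_fin.
- by apply: measurable_funTS; exact/measurable_EFinP.
- by move=> z _; rewrite lee_fin.
- by apply: measurable_funTS; exact/measurable_EFinP.
Qed.

Let half : exists2 K : R, 0 < K &
  [/\ (\int[leb]_(z in `]-oo, m]) (f (z - u)%R * f z)%:E = K%:E)%E,
      (\int[leb]_(z in `]m, +oo[) (f (z - u)%R * f z)%:E = K%:E)%E,
      (\int[leb]_(z in `]-oo, m]) (f z * f (z - u)%R)%:E = K%:E)%E &
      (\int[leb]_(z in `]m, +oo[) (f z * f (z - u)%R)%:E = K%:E)%E].
Proof.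
have [K K0 [klo khi]] := cond_median_half hf hmed u0; exists K => //.
by split=> //; [rewrite -klo|rewrite -khi]; apply: eq_integral => z _; rewrite mulrC.
Qed.

Let lr1 x y : x < y -> f (x - u) * f (y + t - u) <= f (x + t - u) * f (y - u).
Proof.
move=> xy; rewrite !(addrAC _ t); apply: MLR_shift => //.
by rewrite ltrD2r.
Qed.
Let lr2 x y : x < y -> f x * f (y + t) <= f (x + t) * f y.
Proof. by move=> xy; exact: MLR_shift. Qed.

Let le1 : (\int[leb]_(z in `]m, +oo[) (g1 z)%:E <=
  \int[leb]_(z in `]-oo, m]) (g1 z)%:E)%E.
Proof.
have [K K0 [_ _ klo khi]] := half.
exact: (shifted_mass_le mf f0 (mfB u) (fun=> f0 _) lr1 K0 klo khi).
Qed.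

Let le2 : (\int[leb]_(z in `]m, +oo[) (g2 z)%:E <=
  \int[leb]_(z in `]-oo, m]) (g2 z)%:E)%E.
Proof.
have [K K0 [klo khi _ _]] := half.
exact: (shifted_mass_le (mfB u) (fun=> f0 _) mf f0 lr2 K0 klo khi).
Qed.

Lemma cond_weight_median_le :
  (\int[leb]_(z in `]med u, +oo[) (cond_weight f th u z)%:E <=
   \int[leb]_(z in `]-oo, med u]) (cond_weight f th u z)%:E)%E.
Proof. by rewrite !weightE//; exact: leeD. Qed.

Hypotheses (tgt0 : 0 < spread th) (tu : spread th < u).

Let sub_lty (g : R -> R) D :
  measurable_fun setT g -> (forall x, 0 <= g x) -> measurable D ->
  (\int[leb]_z (g z)%:E < +oo)%E -> (\int[leb]_(z in D) (g z)%:E < +oo)%E.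
Proof.
move=> mg g0 mD; apply: le_lt_trans; apply: ge0_subset_integral => //.
  exact/measurable_EFinP.
by move=> x _; rewrite lee_fin.
Qed.

(** [g1] is the null weight at spread [u - t], positive since [t < u]; [g2] is, up to translation,
    the one at [u + t]. *)
Let fin1 D : measurable D -> (\int[leb]_(z in D) (g1 z)%:E < +oo)%E.
Proof.
move=> mD; apply: sub_lty => //.
have ut0 : 0 < u - t by rewrite subr_gt0.
apply: le_lt_trans (pair_mass_lty hf hmed ut0).
rewrite le_eqVlt; apply/orP; left; apply/eqP; apply: eq_integral => z _.
by rewrite /g1 mulrC (_ : z - (u - t) = z + t - u)//; ring.
Qed.

Let fin2 D : measurable D -> (\int[leb]_(z in D) (g2 z)%:E < +oo)%E.
Proof.
move=> mD; apply: sub_lty => //.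
have ut0 : 0 < u + t by rewrite addr_gt0.
apply: le_lt_trans (pair_mass_lty hf hmed ut0).
rewrite -(@ge0_integral_shift _ t (fun z => (f (z - (u + t)) * f z)%:E)).
- rewrite le_eqVlt; apply/orP; left; apply/eqP; apply: eq_integral => z _.
  by rewrite /g2 opprD addrACA subrr addr0.
- by apply/measurable_EFinP; exact: measurable_funM.
- by move=> x; rewrite lee_fin mulr_ge0.
Qed.

Let fsum1 : (\int[leb]_z (f z)%:E = 1)%E. Proof. by case: hf. Qed.
Let fBsum1 : (\int[leb]_z (f (z - u)%R)%:E = 1)%E.
Proof.
rewrite -fsum1; apply: (@ge0_integral_shift _ (- u) (EFin \o f)).
  exact/measurable_EFinP.
by move=> x; rewrite /= lee_fin.
Qed.

Let pos_mass D : (0 < \int[leb]_(z in D) (f (z - u)%R * f z)%:E)%E ->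
  exists2 z, D z & 0 < f (z - u) /\ 0 < f z.
Proof.
move=> I0; apply: contrapT => H; move: I0; rewrite integral0_eq ?ltxx// => z Dz.
congr EFin; have [->|fzu] := eqVneq (f (z - u)) 0; first by rewrite mul0r.
have [->|fz] := eqVneq (f z) 0; first by rewrite mulr0.
by case: H; exists z => //; rewrite !lt0r fzu fz !f0.
Qed.

Let fin_num D (g : R -> R) : (forall x, 0 <= g x) ->
  (\int[leb]_(z in D) (g z)%:E < +oo)%E ->
  (\int[leb]_(z in D) (g z)%:E)%E \is a fin_num.
Proof.
by move=> g0 lt; rewrite ge0_fin_numE//; apply: integral_ge0 => x _; rewrite lee_fin.
Qed.

(** One summand is strict and the other weak. The strict one is chosen so that [w] vanishes only
    where [phi] and its shift do; finiteness keeps strictness in the sum. *)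
Lemma cond_weight_median_lt :
  (\int[leb]_(z in `]med u, +oo[) (cond_weight f th u z)%:E <
   \int[leb]_(z in `]-oo, med u]) (cond_weight f th u z)%:E)%E.
Proof.
have [K K0 [klo khi klo' khi']] := half; rewrite !weightE//.
have zeroP x : ~ 0 < f x -> f x = 0.
  by move=> /negP; rewrite -leNgt => fx; apply/le_anti; rewrite fx f0.
have [/left_unbounded_support ubd|/right_unbounded_support ubd] := unbounded_support.
  (* Support unbounded to the left: [g2] is strict. A zero of [f] at [x - u] propagates to the
     right, to [x] and [x + t], and [f] is positive from [m] up to a support point [y > m]. *)
  have {}ubd := ubd f0 hMLR.
  have [y my [_ fy]] : exists2 z, `]m, +oo[%classic z & 0 < f (z - u) /\ 0 < f z.
    by apply: pos_mass; rewrite khi lte_fin.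
  apply: lee_ltD => //; first exact: fin_num (fin1 _).
  move: my; rewrite /= in_itv/= andbT => my.
  apply: (@shifted_mass_lt _ (fun z => f (z - u)) f m t K
    _ _ _ _ _ _ _ _ _ _ _ _ (y - m)) => //.
  - move=> x fxu0; split; apply: zeroP => fx.
      by have := ubd (x - u) x; rewrite fxu0 ltxx gtrBl => /(_ u0 fx).
    have := ubd (x - u) (x + t); rewrite fxu0 ltxx => H; apply: notF; apply: H => //.
    by move: u0 t0; lra.
  - exact: fin2.
  - by rewrite subr_gt0.
  - by move=> x mx; rewrite addrC subrK => xy; exact: ubd xy fy.
(* Support unbounded to the right: [g1] is strict. A zero of [f] at [x] propagates to the left, to
   [x - u] and, as [t < u], to [x + t - u]. *)
have {}ubd := ubd f0 hMLR.
have [y my [fyu _]] : exists2 z, `]-oo, m]%classic z & 0 < f (z - u) /\ 0 < f z.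
  by apply: pos_mass; rewrite klo lte_fin.
apply: lte_leD => //; first exact: fin_num (fin2 _).
move: my; rewrite /= in_itv/= => my.
apply: (@shifted_mass_lt _ f (fun z => f (z - u)) m t K
  _ _ _ _ _ _ _ _ _ _ _ _ 1) => //.
- move=> x fx0; split; apply: zeroP => fx.
    by have := ubd (x - u) x; rewrite fx0 ltxx gtrBl => /(_ u0 fx).
  have := ubd (x + t - u) x; rewrite fx0 ltxx => H; apply: notF; apply: H => //.
  by move: tu; rewrite -/t; lra.
- exact: fin1.
- move=> x mx _; apply: (ubd (y - u)) => //.
  by rewrite ltrD2r (le_lt_trans my).
Qed.

End cond_weight_median.

(** * Pitman nearness *)

Section loss.
Context (R : realType).
Variable W : R -> R.
Hypotheses (hW : forall x, 0 <= W x) (hC1 : C1 W).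

Lemma C1_lt a b : a < b -> b <= 0 -> W b < W a.
Proof.
have [W00 Wneg _] := hC1.
move=> ab; rewrite le_eqVlt => /predU1P[b0|b0]; last exact: Wneg.
(* (C1) compares only nonzero points, so the case [b = 0] goes through the midpoint [a / 2]. *)
rewrite b0 W00 in ab *; apply: le_lt_trans (hW (a / 2)) _.
by apply: Wneg; lra.
Qed.

(** [W] is the sum of its restrictions to the two half-lines, extended by 0; these are monotone
    since [W] is nonnegative. *)
Lemma C1_measurable : measurable_fun setT W.
Proof.
have [W00 Wneg Wpos] := hC1.
pose Wp x := if 0 < x then W x else 0.
pose Wm x := if x < 0 then W x else 0.
have -> : W = Wp \+ Wm.
  apply/funext => x; rewrite /Wp /Wm /=.
  by case: ltgtP => [||<-]; rewrite ?addr0 ?add0r.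
apply: measurable_funD.
  apply: nondecreasing_measurable => // x y xy; rewrite /Wp.
  case: ifPn => x0; last by case: ifP.
  rewrite (lt_le_trans x0 xy); move: xy; rewrite le_eqVlt => /predU1P[->//|xy].
  exact/ltW/Wpos.
apply: nonincreasing_measurable => // x y xy; rewrite /Wm.
case: ifPn => y0; last by case: ifP.
rewrite (le_lt_trans xy y0); move: xy; rewrite le_eqVlt => /predU1P[->//|xy].
exact/ltW/Wneg.
Qed.

End loss.

Section measurable_comparison.
Context d (T : measurableType d) (R : realType).
Variables a b : T -> R.
Hypotheses (ma : measurable_fun setT a) (mb : measurable_fun setT b).

Lemma measurable_set_ltr : measurable [set x | a x < b x].
Proof. by rewrite -[X in measurable X]setTI; apply: measurable_fun_ltr. Qed.

Lemma measurable_set_ler : measurable [set x | a x <= b x].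
Proof. by rewrite -[X in measurable X]setTI; apply: measurable_fun_ler. Qed.

Lemma measurable_set_eqr : measurable [set x | a x = b x].
Proof.
rewrite (_ : [set x | _] = [set x | a x == b x]).
  by rewrite -[X in measurable X]setTI; apply: measurable_fun_eqr.
by apply/seteqP; split => x /= /eqP.
Qed.

End measurable_comparison.

Section order_statistics.
Context (R : realType).

Lemma spread_ge0 (p : R * R) : 0 <= spread p.
Proof. by rewrite /spread /Defs.ord1 /ord2 subr_ge0 ge_min le_max lexx. Qed.

Lemma measurable_ord2 : measurable_fun setT (@ord2 R).
Proof. exact: measurable_maxr. Qed.

Lemma measurable_spread : measurable_fun setT (@spread R).
Proof.
by apply: measurable_funB; [exact: measurable_maxr|exact: measurable_minr].
Qed.

End order_statistics.

Section model.
Context (R : realType) (d : measure_display) (T : measurableType d).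
Variables (f : R -> R) (P : R * R -> probability T R) (X1 X2 : {mfun T >-> R}).
Variables (W : R -> R) (m0 : R).
Hypotheses (hf : is_density f) (hmodel : location_model f P X1 X2).
Hypotheses (hMLR : MLR f) (hW : forall x, 0 <= W x) (hC1 : C1 W).
Hypothesis hmed : forall u : R, 0 < u ->
  exists! m, is_median (cond_law f (0, 0) u) m.
Local Notation leb := (@lebesgue_measure R).
Local Notation med := (cond_median f (0, 0)).
Local Notation XX w := (X1 w, X2 w).

Let f0 x : 0 <= f x. Proof. by case: hf. Qed.
Let mf : measurable_fun setT f. Proof. by case: hf. Qed.
Let md u := if 0 < u then med u else 0.
Let mmd : measurable_fun setT md. Proof. exact: measurable_cond_median. Qed.
Let mX : measurable_fun setT (fun w => XX w).
Proof. exact: measurable_fun_pair. Qed.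

Let mevent th S : measurable S ->
  measurable [set w | 0 < spread (XX w) /\ S (ord2 (XX w) - ord2 th, spread (XX w))].
Proof.
move=> mS; rewrite -[X in measurable X]setTI.
have mg : measurable_fun setT (fun p : R * R => (ord2 p - ord2 th, spread p)).
  apply: measurable_fun_pair; last exact: measurable_spread.
  by apply: measurable_funB => //; exact: measurable_ord2.
have mS' : measurable ([set p : R * R | 0 < p.2] `&` S).
  by apply: measurableI => //; exact: measurable_set_ltr.
exact: (measurableT_comp mg mX) measurableT _ mS'.
Qed.

Lemma spread_pos_prob th : P th [set w | 0 < spread (XX w)] = 1%E.
Proof.
have [ind d1 d2] := hmodel th.
have mD : measurable [set p : R * R | p.1 = p.2].
  exact: measurable_set_eqr.
have mfB (a : R) : measurable_fun setT (fun x : R => f (x - a)).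
  by apply: (@measurableT_comp _ _ _ _ _ _ f) => //; exact: measurable_funB.
have PD : P th [set w | X1 w = X2 w] = 0%E.
  have -> := indep_density_pair (mfB th.1) (fun=> f0 _) (mfB th.2) (fun=> f0 _)
    ind d1 d2 mD.
  rewrite integral0_eq// => x _.
  (* The diagonal meets each line of fixed [x] in a single point. *)
  rewrite -(integral_set1 (fun y => (f (x - th.1) * f (y - th.2))%:E) x).
  rewrite [RHS]integral_mkcond; apply: eq_integral => y _.
  rewrite patchE indicE; case: ifPn => yx.
    by rewrite mem_set ?mul1r//=; move: yx; rewrite inE => ->.
  by rewrite memNset ?mul0r//= => xy; move: yx; rewrite notin_setE/=; apply.
have mDw : measurable [set w | X1 w = X2 w].
  by rewrite -[X in measurable X]setTI; exact: mX measurableT _ mD.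
rewrite (_ : [set w | _] = ~` [set w | X1 w = X2 w]).
  by rewrite probability_setC// PD sube0.
apply/seteqP; split => w /=;
  rewrite /spread /Defs.ord1 /ord2/= subr_gt0 gt_min !lt_max !ltxx/= orbF.
  by move=> + X12; rewrite X12 ltxx.
by move=> /eqP; rewrite neq_lt orbC.
Qed.

(** The unnormalised conditional mass of the section of [S] at spread [u]. *)
Let I th (S : set (R * R)) (u : R) : \bar R :=
  (\int[leb]_z (\1_S (z, u) * cond_weight f th u z)%:E)%E.

Let IE th (S : set (R * R)) (u : R) (D : set R) : [set z | S (z, u)] = D ->
  (I th S u = \int[leb]_(z in D) (cond_weight f th u z)%:E)%E.
Proof.
move=> <-; rewrite /I [RHS]integral_mkcond; apply: eq_integral => z _.
rewrite patchE indicE (_ : ((z, u) \in S) = (z \in [set z | S (z, u)])).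
  by case: ifP => _; rewrite ?mul1r ?mul0r.
by apply/idP/idP; rewrite !inE.
Qed.

Let I_ge0 th S u : (0 <= I th S u)%E.
Proof. by apply: integral_ge0 => z _; rewrite lee_fin mulr_ge0// cond_weight_ge0. Qed.

Let mI th S : measurable S -> measurable_fun setT (I th S).
Proof.
move=> mS; apply: (measurable_fun_fubini_tonelli_G (m1 := leb)
  (fun p : R * R => (\1_S p * cond_weight f th p.2 p.1)%:E)).
  apply/measurable_EFinP; apply: measurable_funM; first exact: measurable_indic.
  exact: measurable_cond_weight.
by move=> p; rewrite lee_fin mulr_ge0// cond_weight_ge0.
Qed.

(* Sets of pairs (z, u) of values of X_(2) - theta_(2) and of the spread. *)
Let SA : set (R * R) := [set p | md p.2 < m0].
Let SB := SA `&` [set p | p.1 <= md p.2].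
Let SC := SA `&` [set p | md p.2 < p.1].
Let mmd2 : measurable_fun setT (fun p : R * R => md p.2).
Proof. exact: measurableT_comp. Qed.
Let mSA : measurable SA.
Proof. exact: measurable_set_ltr. Qed.
Let mSB : measurable SB.
Proof.
by apply: measurableI => //; exact: measurable_set_ler.
Qed.
Let mSC : measurable SC.
Proof.
by apply: measurableI => //; exact: measurable_set_ltr.
Qed.

Let event th S :=
  [set w | 0 < spread (XX w) /\ S (ord2 (XX w) - ord2 th, spread (XX w))].

Let IB th u : 0 < u -> md u < m0 ->
  (I th SB u = \int[leb]_(z in `]-oo, med u]) (cond_weight f th u z)%:E)%E.
Proof.
move=> u0 um0; apply: IE; apply/seteqP; split => z;
  rewrite /SB /SA /= in_itv/= /md u0.
  by case.
by move: um0; rewrite /md u0.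
Qed.

Let IC th u : 0 < u -> md u < m0 ->
  (I th SC u = \int[leb]_(z in `]med u, +oo[) (cond_weight f th u z)%:E)%E.
Proof.
move=> u0 um0; apply: IE; apply/seteqP; split => z;
  rewrite /SC /SA /= in_itv/= andbT /md u0.
  by case.
by move: um0; rewrite /md u0.
Qed.

Let I0 th S u : S `<=` SA -> ~ (md u < m0) -> I th S u = 0%E.
Proof.
move=> SSA um0; rewrite (@IE _ _ _ set0) ?integral_set0//.
by apply/seteqP; split => z //= /SSA.
Qed.

Let IC_le_IB th u : 0 < u -> (I th SC u <= I th SB u)%E.
Proof.
move=> u0; have [um0|um0] := boolP (md u < m0).
  by rewrite (IB th u0 um0) (IC th u0 um0); exact: cond_weight_median_le.
by rewrite !I0//; [move=> p []|exact/negP|move=> p []|exact/negP].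
Qed.

Let PE th S : measurable S ->
  (P th (event th S) = \int[leb]_(u in `]0%R, +oo[) I th S u)%E.
Proof. by move=> mS; exact: (spread_law hf hmodel). Qed.

Let PC_le_PB th : (P th (event th SC) <= P th (event th SB))%E.
Proof.
rewrite (PE th mSC) (PE th mSB); apply: ge0_le_integral.
- exact: measurable_itv.
- by move=> u _; exact: I_ge0.
- by apply: measurable_funTS; exact: mI.
- by apply: measurable_funTS; exact: mI.
- by move=> u; rewrite /= in_itv/= andbT; exact: IC_le_IB.
Qed.

Let L th delta w := W (delta (XX w) - ord2 th).

Let mL th delta : measurable_fun setT delta -> measurable_fun setT (L th delta).
Proof.
move=> mdelta; apply: measurableT_comp; first exact: C1_measurable.
apply: measurable_funB => //; exact: (measurableT_comp mdelta mX).
Qed.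

Let mPN : measurable_fun setT (delta_PN m0).
Proof. by apply: measurable_funB => //; exact: measurable_ord2. Qed.

(** A spread that is not positive is 0, where the median is the single value [med 0]. *)
Let mmed : measurable_fun setT (fun p : R * R => med (spread p)).
Proof.
rewrite (_ : (fun p => _) = fun p => if 0 < spread p then md (spread p) else med 0).
  exact: (measurable_fun_ifT
    (measurable_fun_ltr (measurable_cst _) (@measurable_spread R))
    (measurableT_comp mmd (@measurable_spread R)) (measurable_cst _)).
apply/funext => p; rewrite /md; have := spread_ge0 p.
by rewrite le_eqVlt => /predU1P[<-|->]; rewrite ?ltxx.
Qed.

Let mPNs : measurable_fun setT (delta_PN_star f m0).
Proof.
apply: measurable_funB; first exact: measurable_ord2.
exact: (measurable_minr (measurable_cst _) mmed).
Qed.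

Local Notation gpn := (GPN P X1 X2 W (delta_PN_star f m0) (delta_PN m0)).

(** Losses are strictly ordered on [SB] and tied off [SA], where the minimum is [m0]; the
    contribution of [SC] is dropped. *)
Let GPN_ge th :
  (P th (event th SB) + 2^-1%:E * P th (event th (~` SA)) <= gpn th)%E.
Proof.
rewrite /GPN; apply: leeD.
  apply: le_measure; rewrite ?inE.
  - exact: mevent.
  - exact: measurable_set_ltr (mL th mPNs) (mL th mPN).
  - move=> w [s0 []]; rewrite /SA/= /md s0 => mm0 zm.
    apply: C1_lt => //; rewrite /delta_PN_star /delta_PN (min_r (ltW mm0)).
      by rewrite ltrD2r ltrD2l ltrN2.
    by rewrite addrAC subr_le0.
rewrite lee_pmul2l ?lte_fin//.
apply: le_measure; rewrite ?inE.
- by apply: mevent; exact: measurableC.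
- exact: measurable_set_eqr (mL th mPNs) (mL th mPN).
- move=> w [s0 /= /negP]; rewrite /SA /= /md s0 -leNgt => mm0.
  by rewrite /delta_PN_star /delta_PN min_l.
Qed.

Let events_sum th :
  (P th (event th SB) + P th (event th SC) + P th (event th (~` SA)) = 1)%E.
Proof.
have mB := mevent th mSB; have mC := mevent th mSC.
have mA := mevent th (measurableC mSA).
rewrite -(spread_pos_prob th).
have -> : [set w | 0 < spread (XX w)] =
    (event th SB `|` event th SC) `|` event th (~` SA).
  apply/seteqP; split => w; last by case=> [[]|] [].
  move=> /= s0; have [um|um] := boolP (md (spread (XX w)) < m0).
    have [zm|zm] := leP (ord2 (XX w) - ord2 th) (md (spread (XX w))).
      by left; left.
    by left; right.
  by right; split => //; exact/negP.
rewrite measureU//; last 2 first.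
- exact: measurableU.
- by apply/seteqP; split => w // [[[_ [? _]]|[_ [? _]]] [_]].
rewrite measureU//.
apply/seteqP; split => w // [[_ [_ /= h]] [_ [_ /=]]].
by rewrite ltNge h.
Qed.

Let finP th S : measurable S -> exists r : R, P th (event th S) = r%:E.
Proof.
move=> mS; exists (fine (P th (event th S))); rewrite fineK// fin_num_measure//.
exact: mevent.
Qed.

(** With masses [b], [c], [a] of sum 1 for [SB], [SC] and the complement of [SA], the lower bound
    [b + a / 2] equals [1 / 2 + (b - c) / 2]. *)
Lemma GPN_half th : ((2^-1)%:E <= gpn th)%E.
Proof.
apply: le_trans (GPN_ge th).
have := events_sum th; have := PC_le_PB th.
have [b ->] := finP th mSB; have [c ->] := finP th mSC.
have [a ->] := finP th (measurableC mSA).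
by rewrite -EFinM -!EFinD !lee_fin => cb [sum]; lra.
Qed.

Let GPN_half_lt th : (P th (event th SC) < P th (event th SB))%E ->
  ((2^-1)%:E < gpn th)%E.
Proof.
move=> ltCB; apply: lt_le_trans (GPN_ge th); move: ltCB.
have := events_sum th.
have [b ->] := finP th mSB; have [c ->] := finP th mSC.
have [a ->] := finP th (measurableC mSA).
by rewrite -EFinM -!EFinD !lte_fin => -[sum] cb; lra.
Qed.

Let A : set R := [set u | 0 < u] `&` [set u | md u < m0].
Let An n : set R := A `&` [set u | n.+1%:R^-1 < u].
Let mA : measurable A.
Proof.
apply: measurableI.
  exact: (measurable_set_ltr (measurable_cst _) (@measurable_id _ _ _)).
exact: (measurable_set_ltr mmd (measurable_cst _)).
Qed.
Let mAn n : measurable (An n).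
Proof.
apply: (measurableI _ _ mA).
exact: (measurable_set_ltr (measurable_cst _) (@measurable_id _ _ _)).
Qed.

Hypothesis hpos : exists th,
  P th [set w | cond_median f (0, 0) (spread (X1 w, X2 w)) < m0] <> 0%E.

(** By [spread_law] a null [A] would be avoided by the spread almost surely under every parameter,
    against [hpos]. *)
Let A_nonnull : leb A <> 0%E.
Proof.
have [th] := hpos; apply: contra_not => A0.
have mU : measurable (event th SA) by exact: mevent.
have U0 : P th (event th SA) = 0%E.
  rewrite PE//.
  have -> : (\int[leb]_(u in `]0%R, +oo[) I th SA u =
      \int[leb]_(u in A) I th SA u)%E.
    rewrite [LHS]integral_mkcond [RHS]integral_mkcond; apply: eq_integral => u _.
    rewrite !patchE; have [uA|uA] := boolP (u \in A).
      by rewrite mem_set//=; move: uA; rewrite inE => -[u0 _]; rewrite in_itv/= andbT.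
    case: ifPn => //; rewrite inE/= in_itv/= andbT => u0; apply: I0 => // um.
    by move: uA; rewrite notin_setE; apply.
  apply: null_set_integral; [exact: mA| |exact: A0].
  by apply: measurable_funTS; exact: mI.
have mN : measurable [set w | 0 < spread (XX w)].
  apply: measurable_set_ltr => //.
  exact: (measurableT_comp (@measurable_spread R) mX).
have N0 : P th (~` [set w | 0 < spread (XX w)]) = 0%E.
  by rewrite probability_setC// spread_pos_prob subee.
apply: (subset_measure0 (B := event th SA `|` ~` [set w | 0 < spread (XX w)])).
- apply: measurable_set_ltr => //; exact: (measurableT_comp mmed mX).
- by apply: measurableU => //; exact: measurableC.
- move=> w /= mm0; have [s0|s0] := boolP (0 < spread (XX w)); last first.
    by right; exact/negP.
  by left; split => //; rewrite /SA/= /md s0.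
- rewrite -U0; apply: measureU0 => //; exact: measurableC.
Qed.

Let An_nonnull : exists n, leb (An n) <> 0%E.
Proof.
apply: contrapT => /forallNP H; apply: A_nonnull.
have -> : A = \bigcup_n An n.
  apply/seteqP; split => u; last by case=> n _ [].
  (* The integer part [n] of the inverse of [u] satisfies [1 / u < n + 1]. *)
  move=> uA; have [u0 _] := uA; exists (Num.truncn u^-1) => //; split => //=.
  rewrite invf_plt ?posrE ?ltr0n//; exact: Num.Theory.truncnS_gt.
apply/negligibleP; first exact: bigcupT_measurable mAn.
apply: negligible_bigcup => n; apply/negligibleP; first exact: mAn.
exact: contrapT (H n).
Qed.

Lemma GPN_strict : exists th, ((2^-1)%:E < gpn th)%E.
Proof.
have [n An0] := An_nonnull.
(* This gap between the parameters is smaller than every spread in [An n], as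
   [cond_weight_median_lt] requires. *)
pose t : R := n.+1%:R^-1; pose th := (0%R : R, t).
have t0 : 0 < t by rewrite invr_gt0 ltr0n.
have spt : spread th = t.
  by rewrite /spread /Defs.ord1 /ord2/= max_r ?min_l ?subr0// ltW.
exists th; apply: GPN_half_lt; rewrite lt_neqAle PC_le_PB andbT.
apply/negP => /eqP; rewrite (PE th mSC) (PE th mSB) => eqI.
(* Equal probabilities would make the two conditional masses agree for almost every spread, while
   they differ throughout the non-null set [An n]. *)
have [] := @ge0_le_integral_ae_eq _ _ _ leb [set` `]0, +oo[] (I th SC) (I th SB).
- exact: measurable_itv.
- by apply: measurable_funTS; exact: mI.
- by apply: measurable_funTS; exact: mI.
- by move=> u _; exact: I_ge0.
- by move=> u; rewrite /= in_itv/= andbT; exact: IC_le_IB.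
- rewrite -(PE th mSB); apply: le_lt_trans (probability_le1 _ _) _; last exact: ltry.
  exact: mevent.
- exact: eqI.
move=> N [mN N0 subN]; apply: An0.
suff AN : An n `<=` N.
  exact: (@subset_measure0 _ _ _ leb (An n) N (mAn n) mN AN N0).
move=> u [[u0 um] tu]; apply: subN => /= H.
have {H} : I th SB u = I th SC u by apply: H; rewrite in_itv/= andbT.
rewrite (IB th u0 um) (IC th u0 um) => E.
have := @cond_weight_median_lt _ _ hf hMLR hmed th u u0.
by rewrite spt E ltxx => /(_ t0 tu).
Qed.

End model.

Theorem corollary4p5 (R : realType) (d : measure_display) (T : measurableType d)
    (f : R -> R) (P : R * R -> probability T R) (X1 X2 : {mfun T >-> R})
    (W : R -> R) (m0 : R)
    (hf : is_density f)
    (hmodel : location_model f P X1 X2)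
    (hMLR : MLR f)
    (hW : forall x, 0 <= W x) (hC1 : C1 W) (hC2 : C2 W) (hC3 : C3 f W)
    (hm0 : (\int[lebesgue_measure]_(x in [set` `]-oo, m0]]) (f x)%:E = (2^-1)%:E)%E)
    (hmed : forall u, 0 < u ->
       exists! m, is_median (cond_law f (0, 0) u) m)
    (hpos : exists th, P th
       [set w | cond_median f (0, 0) (spread (X1 w, X2 w)) < m0] <> 0%E) :
  pitman_nearer P X1 X2 W (delta_PN_star f m0) (delta_PN m0).
Proof.
split=> [th|].
  exact: (GPN_half m0 hf hmodel hMLR hW hC1 hmed).
exact: (GPN_strict hf hmodel hMLR hW hC1 hmed hpos).
Qed.
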